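(* Let $A$ be a non-trivial $F_\sigma$ subset of $\mathbb{R}$. Then $A$ satisfies condition $(\mathrm{I})$ if and only if $A$ is reducible to $\mathbb{Q}$.
   Context: A subset of $\mathbb{R}$ is non-trivial if both it and its complement are nonempty. For subsets $A,B$ of $\mathbb{R}$, $A$ is reducible to $B$ if there is a continuous function $f\colon\mathbb{R}\to\mathbb{R}$ with $A=f^{-1}(B)$. A subset $A$ of $\mathbb{R}$ satisfies condition $(\mathrm{I}_0)$ if it contains the (real) end points of any (non-degenerate) interval that it contains as a subset. It satisfies $(\mathrm{I}_1)$ if its complement $\mathbb{R}\setminus A$ satisfies $(\mathrm{I}_0)$, and it satisfies $(\mathrm{I})$ if both $(\mathrm{I}_0)$ and $(\mathrm{I}_1)$ hold. *)

(* Defs.v *)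
From mathcomp Require Import all_boot all_order all_algebra.
From mathcomp Require Import all_classical all_reals all_analysis borel_hierarchy.
Set Implicit Arguments.
Unset Strict Implicit.
Unset Printing Implicit Defensive.
Import Order.TTheory GRing.Theory Num.Theory.
Import numFieldNormedType.Exports.
Local Open Scope classical_set_scope.
Local Open Scope ring_scope.

Definition nontrivial_set (T : Type) (A : set T) : Prop :=
  A !=set0 /\ ~` A !=set0.

Definition reducible (R : realType) (A B : set R) : Prop :=
  exists2 f : R -> R, continuous f & A = f @^-1` B.

Definition nondegenerate_itv (R : realType) (i : interval R) : Prop :=
  exists x y : R, [/\ x \in i, y \in i & x < y].

(* Infinite bounds contribute no end point.  When [i] is nonempty, this
   depends only on the set [[set` i]]: its finite bounds are its inf and sup. *)
Definition real_endpoint (R : realType) (i : interval R) (e : R) : Prop :=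
  exists b : bool, i.1 = BSide b e \/ i.2 = BSide b e.

Definition cond_I0 (R : realType) (A : set R) : Prop :=
  forall i : interval R, nondegenerate_itv i -> [set` i] `<=` A ->
    forall e : R, real_endpoint i e -> A e.

Definition cond_I1 (R : realType) (A : set R) : Prop := cond_I0 (~` A).

Definition cond_I (R : realType) (A : set R) : Prop := cond_I0 A /\ cond_I1 A.

(* Main.v *)
(* The intermediate value theorem gives the direction from reducibility to (I).

   For the converse, let two reals be equivalent when the segment between them lies
   within [A] or within its complement.  By (I) inequivalent points can be interpolated, so
   a Cantor-like continuous nondecreasing function [phi] collapses exactly the equivalence
   classes.  Then [A] is the preimage under [phi] of an F_sigma set that is dense and
   codense in the interval [range phi], and adding the rationals outside that interval makes
   it dense and codense in [R].

   If [A], the union of closed sets [F n], is dense and codense, build continuous [f n] and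
   tolerances [e n >= 0] with [|f n.+1 - f n| <= e n] and [e n.+1 <= e n / 4].  The zeros of
   [e n] are the points where the value is frozen; they lie in [A] and their values are
   rational.  The set [F n] is frozen by stage [n.+1], and [e n.+1 <= |f n.+1 - q| / 4], for
   the [n]-th rational [q], prevents the limit from taking the value [q] outside [A].  One
   step works on a Whitney decomposition of [{e n > 0}] into dyadic intervals: on
   each of them [f n.+1] is constant except on a subinterval missing the nowhere dense
   [F n], and it crosses [q] only at a point of [A]. *)
Require Import Defs.
From mathcomp Require Import all_boot all_order all_algebra.
From mathcomp Require Import all_classical all_reals all_analysis borel_hierarchy.
From mathcomp Require Import zify ring lra.
Set Implicit Arguments.
Unset Strict Implicit.
Unset Printing Implicit Defensive.
Import Order.TTheory GRing.Theory Num.Theory.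
Import numFieldNormedType.Exports.
Local Open Scope classical_set_scope.
Local Open Scope ring_scope.

(** * Continuity, distance functions, density of rationals and irrationals, limits with error
    bounds *)

Section Basics.
Variable R : realType.
Implicit Types (f g : R -> R) (F : set R) (x y : R).

Lemma continuous_epsP f : continuous f <->
  forall x e, 0 < e ->
    exists2 d, 0 < d & forall y, `|y - x| < d -> `|f y - f x| < e.
Proof.
split=> [fc x e e0|H x].
  have /cvgrPdist_lt/(_ e e0) := fc x.
  rewrite near_nbhs => /nbhs_ballP[d /= d0 dP]; exists d => // y yx.
  by rewrite distrC; apply: dP; rewrite /ball/= distrC.
apply/cvgrPdist_lt => e /(H x)[d d0 dP].
apply/nbhs_ballP; exists d => // y; rewrite /ball/= => yx.
by rewrite distrC; apply: dP; rewrite distrC.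
Qed.

Lemma closed_notinP F x : closed F -> ~ F x ->
  exists2 d, 0 < d & forall y, `|y - x| < d -> ~ F y.
Proof.
move=> /closed_openC Fo Fx.
have /nbhs_ballP[d /= d0 dP] := open_nbhs_nbhs (conj Fo Fx).
by exists d => // y yx; apply: dP; rewrite /ball/= distrC.
Qed.

Lemma lipschitz1_continuous f :
  (forall x y, f x <= f y + `|x - y|) -> continuous f.
Proof.
move=> fl; apply/continuous_epsP => x e e0; exists e => // y yx.
have := fl x y; have := fl y x; rewrite (distrC x y) ltr_norml => H1 H2.
by apply/andP; split; lra.
Qed.

(** The witness is the distance to [F] truncated at 1; putting 1 into [D x] keeps the infimum
    meaningful when [F] is empty. *)
Lemma closed_zero_set F : closed F ->
  exists d : R -> R,
    [/\ continuous d, forall x, 0 <= d x & forall x, d x = 0 <-> F x].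
Proof.
move=> Fc.
pose D x := [set (1 : R)] `|` [set `|x - y| | y in F].
have D0 x : lbound (D x) 0 by move=> _ [->//|[y _ <-]//].
have Dl x : has_lbound (D x) by exists 0; exact: D0.
have Dn x : D x !=set0 by exists 1; left.
exists (fun x => inf (D x)); split.
- apply: lipschitz1_continuous => x y; rewrite -lerBlDr.
  apply: lb_le_inf => // _ [->|[z Fz <-]].
    rewrite lerBlDr; apply: (@le_trans _ _ 1); last by rewrite lerDl.
    by apply: ge_inf => //; left.
  rewrite lerBlDr; apply: (@le_trans _ _ `|x - z|).
    by apply: ge_inf => //; right; exists z.
  by have := ler_distD y x z; lra.
- by move=> x; apply: lb_le_inf.
move=> x; split=> [d0|Fx]; last first.
  apply/eqP; rewrite eq_le lb_le_inf// andbT.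
  by apply: ge_inf => //; right; exists x => //; rewrite subrr normr0.
apply: contrapT => /(closed_notinP Fc)[d d_gt0 dP].
have : Num.min 1 d <= inf (D x).
  apply: lb_le_inf => // _ [->|[y Fy <-]]; rewrite ge_min ?lexx//.
  apply/orP; right; rewrite leNgt distrC; apply/negP => /dP; exact.
by rewrite d0 leNgt lt_min ltr01 d_gt0.
Qed.

Lemma exists_rational_btw x y : x < y -> exists2 q, rational q & x < q < y.
Proof.
move=> /rat_in_itvoo[q]; rewrite in_itv/= => xqy.
by exists (ratr q) => //; exists q.
Qed.

Lemma exists_irrational_btw x y : x < y ->
  exists2 v, ~ rational v & x < v < y.
Proof.
(* The irrational is a rational translate of [pi]. *)
move=> xy; have /rat_in_itvoo[q] : x - pi < y - pi by rewrite ltrD2r.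
rewrite in_itv/= ltrBlDr ltrBrDr => /andP[H1 H2].
exists (ratr q + pi); last by rewrite H1.
move=> [p _ pE]; apply: (@pi_irrationnal R); exists (p - q) => //.
by rewrite rmorphB/= pE addrC addKr.
Qed.

Lemma exists_exprV_lt (b : nat) (e : R) : (1 < b)%N -> 0 < e ->
  exists n, b%:R^-1 ^+ n < e.
Proof.
move=> b1 e0; exists (Num.bound e^-1).
rewrite exprVn invf_plt ?posrE ?exprn_gt0// ?ltr0n ?(ltn_trans _ b1)//.
apply: (@lt_trans _ _ ((Num.bound e^-1)%:R)).
  by rewrite archi_boundP// invr_ge0 ltW.
by rewrite -natrX ltr_nat ltn_expl.
Qed.

(* [u n - 2 * e n] increases and [u n + 2 * e n] decreases, so that
   [sup_n (u n - 2 * e n)] is a limit with explicit error bounds. *)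
Lemma geometric_limit (u e : nat -> R -> R) :
  (forall n x, 0 <= e n x) -> (forall n x, `|u n.+1 x - u n x| <= e n x) ->
  (forall n x, e n.+1 x <= e n x / 4%:R) -> (forall x, e 0 x <= 1) ->
  exists f : R -> R, [/\ forall n x, `|f x - u n x| <= 2%:R * e n x,
    forall n x, e n x <= 4%:R^-1 ^+ n &
    (forall n, continuous (u n)) -> continuous f].
Proof.
move=> e0 ue ee e1.
have eb n x : e n x <= 4%:R^-1 ^+ n.
  elim: n => [|n IH]; first by rewrite expr0.
  rewrite exprSr; apply: (le_trans (ee n x)); by rewrite ler_pM2r.
have lo x : {homo (fun n => u n x - 2%:R * e n x) : m n / (m <= n)%N >-> m <= n}.
  apply: homo_leq => [?//|? ? ?|n]; first exact: le_trans.
  by have := ue n x; rewrite ler_norml => /andP[? ?]; have := ee n x; lra.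
have hi x : {homo (fun n => u n x + 2%:R * e n x) : m n / (m <= n)%N >-> n <= m}.
  apply: homo_leq => [?//|? ? ? H1 H2|n]; first exact: le_trans H2 H1.
  by have := ue n x; rewrite ler_norml => /andP[? ?]; have := ee n x; lra.
have lohi x m n : u m x - 2%:R * e m x <= u n x + 2%:R * e n x.
  apply: (@le_trans _ _ (u (maxn m n) x - 2%:R * e (maxn m n) x)).
    by apply: (lo x); rewrite leq_maxl.
  apply: (@le_trans _ _ (u (maxn m n) x + 2%:R * e (maxn m n) x)).
    by have := e0 (maxn m n) x; lra.
  by apply: (hi x); rewrite leq_maxr.
pose D x := range (fun n => u n x - 2%:R * e n x).
pose f x := sup (D x).
have fu n x : `|f x - u n x| <= 2%:R * e n x.
  rewrite ler_distl; apply/andP; split.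
    apply: ub_le_sup; last by exists n.
    by exists (u n x + 2%:R * e n x) => _ [m _ <-].
  apply: ge_sup; first by exists (u 0 x - 2%:R * e 0 x), 0%N.
  by move=> _ [m _ <-].
exists f; split=> // uc; apply/continuous_epsP => x r r0.
have [n nr] : exists n, 4%:R^-1 ^+ n < r / 8%:R.
  by apply: exists_exprV_lt; rewrite ?divr_gt0.
have r2 : 0 < r / 2%:R by rewrite divr_gt0.
have /continuous_epsP/(_ x _ r2)[d d0 dP] := uc n.
exists d => // y /dP.
have := fu n x; have := fu n y; have := eb n x; have := eb n y.
rewrite !ler_norml !ltr_norml => ? ? /andP[? ?] /andP[? ?] /andP[? ?].
by apply/andP; split; lra.
Qed.

End Basics.

(** * Passing from one rational value to another *)

Section Transition.
Variable R : realType.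
Implicit Types (A F : set R).

Lemma continuous_ramp (c p : R) : c < p -> exists h : R -> R,
  [/\ continuous h, forall x, 0 <= h x <= 1,
      forall x, h x = 0 <-> x <= c & forall x, h x = 1 <-> p <= x].
Proof.
move=> cp; have k0 : 0 < (p - c)^-1 by rewrite invr_gt0 subr_gt0.
have kE x : 1 <= (x - c) / (p - c) = (p <= x).
  by rewrite ler_pdivlMr ?subr_gt0// mul1r lerD2r.
exists ((cst 0) \max ((cst 1) \min (fun x => (x - c) / (p - c)))); split=> [|x|x|x].
- apply: max_fun_continuous; first exact: cst_continuous.
  apply: min_fun_continuous; first exact: cst_continuous.
  move=> x; apply: cvgM; last exact: cvg_cst.
  by apply: cvgB; [exact: cvg_id|exact: cvg_cst].
- by rewrite /= ge_max ler01 ge_min lexx le_max lexx.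
- rewrite /=; split=> [h0|xc]; last first.
    by apply/max_idPl; rewrite ge_min mulr_le0_ge0 ?orbT ?subr_le0// ltW.
  rewrite leNgt; apply/negP => cx.
  suff : 0 < Num.max 0 (Num.min 1 ((x - c) / (p - c))) by rewrite h0 ltxx.
  by rewrite lt_max lt_min ltr01 mulr_gt0 ?orbT// subr_gt0.
- rewrite -kE /=; split=> [|h1]; last first.
    by rewrite (min_idPl h1); apply/max_idPr; rewrite ler01.
  rewrite leNgt => h1; apply/negP => l1.
  suff : Num.max 0 (Num.min 1 ((x - c) / (p - c))) < 1 by rewrite h1 ltxx.
  by rewrite gt_max ltr01 gt_min l1 orbT.
Qed.

(** All movement takes place on an interval [[c, d]] whose interior misses [F], so on [F] only the
    values [u] and [v] occur. Two ramps meet at a point [p] of [A], the only place where [q] may be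
    taken. *)
Lemma transition A F (a b u v q : R) :
  (forall x y, x < y -> exists2 p, A p & x < p < y) ->
  (forall x y, x < y ->
    exists c d, [/\ x < c, c < d, d < y & forall z, c < z < d -> ~ F z]) ->
  rational u -> rational v -> u != q -> v != q -> a < b ->
  exists T : R -> R,
    [/\ continuous T, (forall x, x <= a -> T x = u) /\ (forall x, b <= x -> T x = v),
      forall x y e, `|u - y| <= e -> `|v - y| <= e -> `|T x - y| <= e,
      forall x, F x -> rational (T x) & forall x, T x = q -> A x].
Proof.
move=> Ad Fn uQ vQ uq vq ab.
have [c [d [ac cd db Fcd]]] := Fn _ _ ab.
have [p Ap /andP[cp pd]] := Ad _ _ cd.
(* The level [w] of [T] at [p] is [q] if [q] separates [u] from [v], so that the crossing happens at
   [p]; otherwise it is [u], and [q] is avoided. *)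
have [w [wq uw]] : exists w, [/\ (w = q /\ 0 < (u - q) * (q - v)) \/
    (w = u /\ 0 < (u - q) * (v - q)) & exists2 t, 0 <= t <= 1 & w = u + t * (v - u)].
  have [h|h|h] := ltgtP 0 ((u - q) * (v - q)).
  - exists u; split; first by right.
    by exists 0; rewrite ?lexx ?ler01// mul0r addr0.
  - exists q; have h' : 0 < (u - q) * (q - v) by move: h; rewrite -(opprB q v) mulrN; lra.
    split; first by left.
    have uv0 : v - u != 0.
      by apply: contraTneq h => /subr0_eq ->; rewrite -leNgt -expr2 sqr_ge0.
    exists ((q - u) / (v - u)); last by rewrite divfK// addrC subrK.
    have [vu|uv|vu] := ltgtP v u; last by move: uv0; rewrite vu subrr eqxx.
      by rewrite -[_ / _]mulrNN -invrN !opprB ler_pdivlMr ?ler_pdivrMr ?subr_gt0//; apply/andP; split; nra.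
    by rewrite ler_pdivlMr ?ler_pdivrMr ?subr_gt0//; apply/andP; split; nra.
  - by move/esym/eqP: h; rewrite mulf_eq0 !subr_eq0 (negPf uq) (negPf vq).
have [r [rc r01 r0 r1]] := continuous_ramp cp.
have [s [sc s01 s0 s1]] := continuous_ramp pd.
pose T x := u + (w - u) * r x + (v - w) * s x.
have r1s0 x : r x = 1 \/ s x = 0.
  by have [px|xp] := leP p x; [left; apply/r1|right; apply/s0/ltW].
have Tconv x : exists2 t, 0 <= t <= 1 & T x = u + t * (v - u).
  move: uw => [t /andP[t0 t1] wE].
  have /andP[? ?] := r01 x; have /andP[? ?] := s01 x.
  have [E|E] := r1s0 x; rewrite /T E wE.
    by exists (t + (1 - t) * s x); [apply/andP; split; nra|ring].
  by exists (t * r x); [apply/andP; split; nra|ring].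
exists T; split.
- move=> x; apply: cvgD; first apply: cvgD; first exact: cvg_cst.
    by apply: cvgM; [exact: cvg_cst|exact: rc].
  by apply: cvgM; [exact: cvg_cst|exact: sc].
- split=> x xab.
    have /r0 rE : x <= c by lra.
    have /s0 sE : x <= p by lra.
    by rewrite /T rE sE !mulr0 !addr0.
  have /r1 rE : p <= x by lra.
  have /s1 sE : d <= x by lra.
  by rewrite /T rE sE; ring.
- move=> x y e; rewrite !ler_norml => /andP[? ?] /andP[? ?].
  by have [t /andP[t0 t1] ->] := Tconv x; apply/andP; split; nra.
- move=> x Fx; have [xc|cx] := leP x c.
    have /s0 sE : x <= p by lra.
    by rewrite /T ((r0 x).2 xc) sE !mulr0 !addr0.
  have [dx|xd] := leP d x.
    have /r1 rE : p <= x by lra.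
    rewrite /T ((s1 x).2 dx) rE; have -> // : u + (w - u) * 1 + (v - w) * 1 = v.
    by ring.
  by case: (Fcd x) => //; rewrite cx xd.
move=> x; case: wq => [[wE uqv]|[wE uqv]] TE; last first.
  have [t /andP[t0 t1]] := Tconv x; rewrite TE => qE.
  (* Here [u] and [v] lie on the same side of [q], hence so does every convex combination of
     them. *)
  exfalso; have : 0 < ((u - q) * (1 - t) + t * (v - q)) * (u - q).
    have : 0 < (u - q) * (u - q) by rewrite -expr2 exprn_even_gt0 ?subr_eq0.
    by have [->|tn0] := eqVneq t 0; [|have : 0 < t by rewrite lt_def tn0]; nra.
  suff -> : (u - q) * (1 - t) + t * (v - q) = 0 by rewrite mul0r ltxx.
  by rewrite {1 2}qE; ring.
suff -> : x = p by [].
have un : w - u != 0 by rewrite wE subr_eq0 eq_sym.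
have vn : v - w != 0 by rewrite wE subr_eq0.
move: TE; rewrite /T; have [xp|px|//] := ltgtP x p.
  have /s0 -> : x <= p by exact: ltW.
  rewrite -wE => E; have /eqP : (w - u) * (r x - 1) = 0 by lra.
  rewrite mulf_eq0 (negPf un)/= subr_eq0 => /eqP /r1.
  by rewrite leNgt xp.
have /r1 -> : p <= x by exact: ltW.
rewrite -wE => E; have /eqP : (v - w) * s x = 0 by lra.
rewrite mulf_eq0 (negPf vn)/= => /eqP /s0.
by rewrite leNgt px.
Qed.

End Transition.

(** * Dyadic intervals and Whitney decompositions *)

Section Dyadic.
Variable R : realType.

Definition dyadic (n : nat) (k : int) : R := k%:~R * 2%:R^-1 ^+ n.

Lemma dyadic_le n k l : (dyadic n k <= dyadic n l) = (k <= l).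
Proof. by rewrite /dyadic ler_pM2r ?exprn_gt0// ler_int. Qed.

Lemma dyadic_lt n k l : (dyadic n k < dyadic n l) = (k < l).
Proof. by rewrite /dyadic ltr_pM2r ?exprn_gt0// ltr_int. Qed.

Lemma dyadic_shift n d k : dyadic n k = dyadic (n + d) (k * 2 ^+ d).
Proof.
rewrite /dyadic rmorphM rmorphXn/= exprD mulrACA mulrA -mulrA -exprMn.
by rewrite divff ?pnatr_eq0// expr1n mulr1.
Qed.

Lemma dyadic_parent n k :
  dyadic n (k %/ 2)%Z <= dyadic n.+1 k /\
  dyadic n.+1 (k + 1) <= dyadic n ((k %/ 2)%Z + 1).
Proof.
rewrite !(dyadic_shift n 1) !addn1 !dyadic_le expr1; split; lia.
Qed.

Lemma dyadic_step n k : dyadic n (k + 1) = dyadic n k + 2%:R^-1 ^+ n.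
Proof. by rewrite /dyadic rmorphD/= mulrDl mul1r. Qed.

Lemma dyadic_floor n x : exists k, dyadic n k <= x < dyadic n (k + 1).
Proof.
exists (Num.floor (x * 2%:R ^+ n)).
rewrite /dyadic exprVn ler_pdivrMr ?ltr_pdivlMr ?exprn_gt0//.
exact: floor_itv.
Qed.

Lemma dyadic_ceil n x : exists k, dyadic n k < x <= dyadic n (k + 1).
Proof.
have [k /andP[h1 h2]] := dyadic_floor n x.
have [h|h] := eqVneq (dyadic n k) x; last by exists k; rewrite lt_neqAle h h1 ltW.
by exists (k - 1); rewrite subrK h lexx -h dyadic_lt; lia.
Qed.

Lemma exists_dyadic_btw (s t : R) : 0 <= s -> s < t -> t <= 1 ->
  exists n (k : nat), (k <= 2 ^ n)%N /\ s < dyadic n k < t.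
Proof.
move=> s0 st t1; have [n nst] : exists n, 2%:R^-1 ^+ n < t - s.
  by apply: exists_exprV_lt; rewrite ?subr_gt0.
have [k /andP[k1 k2]] := dyadic_floor n s.
have k0 : 0 < k + 1.
  by rewrite -(dyadic_lt n) {1}/dyadic mul0r; exact: le_lt_trans k2.
have kt : dyadic n (k + 1) < t by rewrite dyadic_step; lra.
have kn : k + 1 < (2 ^ n)%N :> int.
  rewrite -(dyadic_lt n); apply: (lt_le_trans kt); apply: (le_trans t1).
  by rewrite /dyadic -pmulrn natrX -exprMn divff ?pnatr_eq0// expr1n.
case: (k + 1) k0 k2 kt kn => // m _ sm mt mn; exists n, m; rewrite sm mt; split=> //.
by rewrite ltz_nat in mn; exact: ltnW.
Qed.

(* [C] consists of the maximal dyadic intervals satisfying [P]. *)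
Lemma whitney_cover (P : R -> R -> Prop) (O : set R) :
  (forall a b a' b', P a b -> a <= a' -> b' <= b -> P a' b') ->
  (forall x, O x -> exists2 d, 0 < d & forall a b, x - d < a -> b < x + d -> P a b) ->
  exists C : R -> R -> Prop,
    [/\ forall a b, C a b -> a < b /\ P a b,
        forall x, O x -> exists a b, C a b /\ a <= x < b,
        forall x, O x -> exists a b, C a b /\ a < x <= b &
        forall a b a' b', C a b -> C a' b' -> [\/ a = a' /\ b = b', b <= a' | b' <= a]].
Proof.
move=> Pher Ploc.
pose Q n k := P (dyadic n k) (dyadic n (k + 1)).
(* The parent of interval [k] has index [k %/ 2]; intervals of level 0, of length 1, have no parent
   and count as maximal. *)
pose M n k := Q n k /\ if n is m.+1 then ~ Q m (k %/ 2)%Z else True.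
pose C a b := exists n k, [/\ a = dyadic n k, b = dyadic n (k + 1) & M n k].
have QC n k : Q n k -> exists a b, [/\ C a b, a <= dyadic n k & dyadic n (k + 1) <= b].
  elim: n k => [|n IH] k Qk.
    by exists (dyadic 0 k), (dyadic 0 (k + 1)); split=> //; exists 0%N, k.
  have [Qp|nQp] := pselect (Q n (k %/ 2)%Z).
    have [p1 p2] := dyadic_parent n k.
    have [a [b [Cab ? ?]]] := IH _ Qp; exists a, b; split=> //.
      exact: le_trans p1.
    exact: le_trans p2 _.
  by exists (dyadic n.+1 k), (dyadic n.+1 (k + 1)); split=> //; exists n.+1, k.
have small x : O x -> exists n, forall k,
    dyadic n k <= x <= dyadic n (k + 1) -> Q n k.
  move=> /Ploc[d d0 dP]; have [n nd] := exists_exprV_lt (b := 2) isT d0.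
  by exists n => k; rewrite dyadic_step => kx; apply: dP; rewrite ?dyadic_step; lra.
exists C; split.
- by move=> a b [n [k [-> -> []]]]; rewrite dyadic_lt; split=> //; lia.
- move=> x Ox; have [n nQ] := small x Ox; have [k /andP[k1 k2]] := dyadic_floor n x.
  have /QC[a [b [Cab ? ?]]] : Q n k by apply: nQ; rewrite k1 ltW.
  by exists a, b; split=> //; apply/andP; split; lra.
- move=> x Ox; have [n nQ] := small x Ox; have [k /andP[k1 k2]] := dyadic_ceil n x.
  have /QC[a [b [Cab ? ?]]] : Q n k by apply: nQ; rewrite k2 ltW.
  by exists a, b; split=> //; apply/andP; split; lra.
have key n d k k' : M n k -> M (n + d)%N k' ->
    [\/ dyadic n k = dyadic (n + d) k' /\ dyadic n (k + 1) = dyadic (n + d) (k' + 1),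
        dyadic n (k + 1) <= dyadic (n + d) k' |
        dyadic (n + d) (k' + 1) <= dyadic n k].
  move=> [Qk _] Mk'; rewrite !(dyadic_shift n d) !dyadic_le.
  have [h|h] := lerP (k' + 1) (k * 2 ^+ d); first by apply: Or33.
  have [h'|h'] := lerP ((k + 1) * 2 ^+ d) k'; first by apply: Or32.
  case: d Mk' h h' => [|d]; rewrite ?addn0 ?addnS.
    by rewrite expr0 !mulr1 => _ ? ?; apply: Or31; have -> : k' = k by lia.
  (* A strictly finer interval overlapping the coarser one has its parent inside it, so the parent
     inherits [P], against maximality. *)
  move=> [_ nQ] h h'; case: nQ; apply: Pher Qk _ _;
    rewrite (dyadic_shift n d) dyadic_le; move: h h'; rewrite exprS;
    move: (2 ^+ d : int) => N; lia.
move=> a b a' b' [n [k [-> -> Mk]]] [n' [k' [-> -> Mk']]].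
have [nn|nn] := leqP n n'.
  by have := key n (n' - n)%N k k' Mk; rewrite subnKC//; apply.
have := key n' (n - n')%N k' k Mk'; rewrite subnKC ?(ltnW nn)// => /(_ Mk).
by case=> [[-> ->]|h|h]; [apply: Or31|apply: Or33|apply: Or32].
Qed.

End Dyadic.

(** * One step of the approximation *)

Section OneStep.
Variable R : realType.
Implicit Types (A F : set R).

Lemma one_step A F (f e : R -> R) (q : R) :
  (forall x y, x < y -> exists2 p, A p & x < p < y) ->
  (forall x y, x < y ->
    exists c d, [/\ x < c, c < d, d < y & forall z, c < z < d -> ~ F z]) ->
  continuous f -> continuous e -> (forall x, 0 <= e x) ->
  exists g : R -> R, [/\ continuous g, forall x, `|g x - f x| <= e x &
    forall x, 0 < e x -> (F x -> rational (g x)) /\ (g x = q -> A x)].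
Proof.
move=> Ad Fn fc ec e0.
(* On a cell, [e] is comparable to a constant [r], and [f] is nearly constant relative to [r]. *)
pose P a b := exists y r, 0 < r /\
  forall x, a <= x <= b -> `|f x - y| <= r / 4%:R /\ r <= e x <= 2%:R * r.
have [|x e_gt0|C [CP Cr Cl Cd]] := @whitney_cover R P [set x | 0 < e x].
- move=> a b a' b' [y [r [r0 rP]]] aa bb; exists y, r; split=> // x /andP[? ?].
  by apply: rP; apply/andP; split; lra.
- have e6 : 0 < e x / 6%:R by rewrite divr_gt0.
  have /continuous_epsP/(_ x _ e6)[d d0 dP] := fc.
  have /continuous_epsP/(_ x _ e6)[d' d'0 d'P] := ec.
  exists (Num.min d d'); first by rewrite lt_min d0.
  have m1 : Num.min d d' <= d by rewrite ge_min lexx.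
  have m2 : Num.min d d' <= d' by rewrite ge_min lexx orbT.
  (* Near [x], [e] stays between 5/6 and 7/6 of [e x], hence between [r] and [2 * r] for
     [r = 2/3 * e x]; moreover [r / 4 = e x / 6]. *)
  move=> a b xa bx; exists (f x), (2%:R / 3%:R * e x); split; first lra.
  move=> z /andP[az zb].
  have /dP : `|z - x| < d by rewrite ltr_norml; apply/andP; split; lra.
  have /d'P : `|z - x| < d' by rewrite ltr_norml; apply/andP; split; lra.
  rewrite !ltr_norml ler_norml => /andP[? ?] /andP[? ?].
  by split; apply/andP; split; lra.
(* The value [r c] depends on the point [c] alone, so that adjacent cells agree at a common end
   point. *)
have /choice[r rP] : forall c, exists r, 0 < e c ->
    [/\ rational r, r != q & `|r - f c| <= e c / 8%:R].
  move=> c; have [c0|_] := ltP 0 (e c); last by exists 0.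
  have e8 : f c < f c + e c / 8%:R by lra.
  have [qf|fq] := leP q (f c).
    have [v vQ /andP[v1 v2]] := exists_rational_btw e8; exists v => _.
    split=> //; first by rewrite gt_eqF//; lra.
    by rewrite ler_norml; apply/andP; split; lra.
  have m : f c < Num.min q (f c + e c / 8%:R) by rewrite lt_min fq.
  have [v vQ /andP[v1]] := exists_rational_btw m; rewrite lt_min => /andP[v2 v3].
  exists v => _; split=> //; first by rewrite lt_eqF.
  by rewrite ler_norml; apply/andP; split; lra.
have CO a b x : C a b -> a <= x <= b -> 0 < e x.
  by move=> /CP[_ [y [s [s0 sP]]]] /sP[_ /andP[? _]]; lra.
have /choice[T TP] : forall ab : R * R, exists T : R -> R, C ab.1 ab.2 ->
    [/\ continuous T, T ab.1 = r ab.1 /\ T ab.2 = r ab.2,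
      forall x, ab.1 <= x <= ab.2 -> `|T x - f x| <= e x,
      forall x, F x -> rational (T x) & forall x, T x = q -> A x].
  move=> [a b]/=; have [Cab|nC] := pselect (C a b); last by exists f.
  have [ab [y [s [s0 sP]]]] := CP _ _ Cab.
  have ae : 0 < e a by apply: (CO _ _ _ Cab); rewrite lexx ltW.
  have be : 0 < e b by apply: (CO _ _ _ Cab); rewrite lexx ltW.
  have [ra1 ra2 ra3] := rP _ ae; have [rb1 rb2 rb3] := rP _ be.
  have [T [Tc [Ta Tb] Te TF TA]] := transition Ad Fn ra1 rb1 ra2 rb2 ab.
  exists T => _; split=> //; first by rewrite Ta ?Tb.
  move=> x xab.
  (* The end values are within [s / 4] of [f], which is within [s / 4] of [y]. Hence [T] is within
     [3 * s / 4] of [f], and [s <= e x]. *)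
  have : `|T x - y| <= s / 2%:R.
    apply: Te.
      have : a <= a <= b by rewrite lexx ltW.
      move=> /sP; move: ra3; rewrite !ler_norml => /andP[? ?] [/andP[? ?] /andP[? ?]].
      by apply/andP; split; lra.
    have : a <= b <= b by rewrite lexx ltW.
    move=> /sP; move: rb3; rewrite !ler_norml => /andP[? ?] [/andP[? ?] /andP[? ?]].
    by apply/andP; split; lra.
  have := sP x xab; rewrite !ler_norml => -[/andP[? ?] /andP[? ?]] /andP[? ?].
  by apply/andP; split; lra.
have /choice[cell cellP] : forall x, exists ab : R * R, 0 < e x ->
    C ab.1 ab.2 /\ ab.1 <= x <= ab.2.
  move=> x; have [/Cr[a [b [Cab /andP[? ?]]]]|_] := ltP 0 (e x).
    by exists (a, b) => _; split=> //=; apply/andP; split; lra.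
  by exists (0, 0).
pose g x := if 0 < e x then T (cell x) x else f x.
have gT a b x : C a b -> a <= x <= b -> g x = T (a, b) x.
  move=> Cab xab; have ex := CO _ _ _ Cab xab.
  rewrite /g ex; have := cellP x ex; case: (cell x) => a' b' /= [Cab' /andP[? ?]].
  move/andP: xab => [? ?].
  have Tend c d z : C c d -> z = c \/ z = d -> T (c, d) z = r z.
    by move=> Ccd; have [_ [Tc Td] _ _ _] := TP (c, d) Ccd; case=> ->.
  have [[-> ->]//|h|h] := Cd _ _ _ _ Cab Cab'.
    by rewrite !Tend//; [right|left]; lra.
  by rewrite !Tend//; [left|right]; lra.
have ge x : `|g x - f x| <= e x.
  have [x0|x0] := ltP 0 (e x); last by rewrite /g ltNge x0/= subrr normr0.
  have := cellP x x0; case: (cell x) => a b /= [Cx xab]; rewrite (gT _ _ _ Cx xab).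
  by have [_ _ + _ _] := TP (a, b) Cx; apply.
exists g; split=> // [|x x0]; last first.
  have := cellP x x0; case: (cell x) => a b /= [Cx xab]; rewrite (gT _ _ _ Cx xab).
  by have [_ _ _ TF TA] := TP (a, b) Cx; split; [exact: TF|exact: TA].
apply/continuous_epsP => x z z0; have [x0|x0] := ltP 0 (e x).
  (* The point [x] may be a common end point of two cells: one cell serves the points to its right,
     the other those to its left. *)
  have [a [b [Cab /andP[ax xb]]]] := Cr _ x0.
  have [a' [b' [Cab' /andP[ax' xb']]]] := Cl _ x0.
  have [/continuous_epsP/(_ x z z0)[d d0 dP] _ _ _ _] := TP (a, b) Cab.
  have [/continuous_epsP/(_ x z z0)[d' d'0 d'P] _ _ _ _] := TP (a', b') Cab'.
  exists (Num.min (Num.min d d') (Num.min (b - x) (x - a'))).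
    by rewrite !lt_min d0 d'0 !subr_gt0 xb ax'.
  move=> y; rewrite !lt_min => /andP[/andP[/dP yd /d'P yd'] /andP[yb ya]].
  have /andP[? ?] : a' < y < b.
    by move: yb ya; rewrite !ltr_norml => /andP[? ?] /andP[? ?]; apply/andP; split; lra.
  have [xy|yx] := leP x y.
    by rewrite (gT a b x)// ?(gT a b y)//; apply/andP; split; lra.
  by rewrite (gT a' b' x)// ?(gT a' b' y)//; apply/andP; split; lra.
(* Cells may accumulate at a zero of [e]; there [|g - f| <= e] and the continuity of [f] and [e]
   suffice. *)
have ex : e x = 0 by have := e0 x; lra.
have z2 : 0 < z / 2%:R by lra.
have /continuous_epsP/(_ x _ z2)[d d0 dP] := fc.
have /continuous_epsP/(_ x _ z2)[d' d'0 d'P] := ec.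
exists (Num.min d d'); first by rewrite lt_min d0.
move=> y; rewrite lt_min => /andP[/dP + /d'P]; have := ge y; have := ge x.
rewrite ex !ler_norml !ltr_norml => /andP[? ?] /andP[? ?] /andP[? ?] /andP[? ?].
by apply/andP; split; lra.
Qed.

End OneStep.

(** * Reduction of a dense and codense set *)

Section DenseCase.
Variable R : realType.

Lemma dense_codense_reducible (A : set R) (F : nat -> set R) :
  (forall n, closed (F n)) -> A = \bigcup_n F n ->
  (forall x y, x < y -> exists2 p, A p & x < p < y) ->
  (forall x y, x < y -> exists2 p, ~ A p & x < p < y) ->
  reducible A (@rational R).
Proof.
move=> Fc AF Ad Acd.
have FA n : F n `<=` A by move=> x Fx; rewrite AF; exists n.
have Fn n x y : x < y ->
    exists c d, [/\ x < c, c < d, d < y & forall z, c < z < d -> ~ F n z].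
  move=> /Acd[p nAp /andP[xp py]].
  have [|d d0 dP] := closed_notinP (Fc n) (x := p); first by move=> /FA.
  have hm : 0 < Num.min d (y - p) by rewrite lt_min d0 subr_gt0.
  have m1 : Num.min d (y - p) <= d by rewrite ge_min lexx.
  have m2 : Num.min d (y - p) <= y - p by rewrite ge_min lexx orbT.
  exists p, (p + Num.min d (y - p) / 2%:R); split; [exact: xp|lra|lra|].
  by move=> z /andP[? ?]; apply: dP; rewrite ltr_norml; apply/andP; split; lra.
pose Q n : R := if unpickle n is Some r then ratr r else 0.
have Qsurj x : rational x -> exists n, x = Q n.
  by move=> [r _ <-]; exists (pickle r); rewrite /Q pickleK.
have Qrat n : rational (Q n).
  by rewrite /Q; case: unpickle => [r|]; [exists r|exists 0; rewrite ?rmorph0].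
(* A pair consists of an approximation and its tolerance. *)
pose inv (p : (R -> R) * (R -> R)) := [/\ continuous p.1, continuous p.2,
  forall x, 0 <= p.2 x & forall x, p.2 x = 0 -> A x /\ rational (p.1 x)].
pose next n (p p' : (R -> R) * (R -> R)) :=
  [/\ forall x, `|p'.1 x - p.1 x| <= p.2 x, forall x, p'.2 x <= p.2 x / 4%:R,
      forall x, p'.2 x <= `|p'.1 x - Q n| / 4%:R & forall x, F n x -> p'.2 x = 0].
have /choice[s sP] : forall np : nat * ((R -> R) * (R -> R)), exists p',
    inv np.2 -> inv p' /\ next np.1 np.2 p'.
  move=> [n [f e]]/=.
  have [[/= fc ec e0 eA]|] := pselect (inv (f, e)); last by exists (f, e).
  have [g [gc ge gP]] := one_step (Q n) Ad (Fn n) fc ec e0.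
  have [d [dc d0 dF]] := closed_zero_set (Fc n).
  (* The three terms yield, in order, the geometric decay, the freezing of [F n] and the protection
     of the value [Q n]. *)
  pose m x := Num.min (e x) (Num.min (d x) `|g x - Q n|).
  have m0 x : 0 <= m x by rewrite !le_min e0 d0 normr_ge0.
  exists (g, fun x => 4%:R^-1 * m x) => _; split; split=> //=.
  - move=> x; apply: cvgM; first exact: cvg_cst.
    suff /(_ x) : continuous m by [].
    apply: (min_fun_continuous ec); apply: (min_fun_continuous dc) => y.
    by apply: cvg_norm; apply: cvgB; [exact: gc|exact: cvg_cst].
  - by move=> x; rewrite mulr_ge0// invr_ge0.
  (* A zero of [m] is an already frozen point, where [g x = f x], or a point of [F n], or one where
     [g] takes the value [Q n]; [one_step] settles the last two. *)
  - move=> x /eqP; rewrite mulf_eq0 invr_eq0 pnatr_eq0/= => /eqP mx.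
    have [ex|ex] := eqVneq (e x) 0.
      by have := ge x; rewrite ex normr_le0 subr_eq0 => /eqP ->; exact: eA.
    have /gP[gF gA] : 0 < e x by rewrite lt_neqAle eq_sym ex e0.
    have [/dF Fx|dx] := eqVneq (d x) 0; first by split; [exact: FA Fx|exact: gF].
    have [gx|gx] := eqVneq (g x) (Q n); first by split; [exact: gA|rewrite gx].
    suff : 0 < m x by rewrite mx ltxx.
    by rewrite !lt_min !lt_neqAle e0 d0 normr_ge0 ![0 == _]eq_sym ex dx
      normr_eq0 subr_eq0 gx.
  - by move=> x; rewrite mulrC ler_pM2r ?invr_gt0// ge_min lexx.
  - by move=> x; rewrite mulrC ler_pM2r ?invr_gt0// !ge_min lexx !orbT.
  - move=> x /dF dx; apply/eqP; rewrite mulf_eq0 invr_eq0 pnatr_eq0/=.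
    by rewrite eq_le m0 andbT !ge_min dx lexx orbT.
pose u := fix u n := if n is k.+1 then s (k, u k) else (fun=> 0, fun=> 1).
have uinv n : inv (u n).
  elim: n => [|n IH]; last by have [] := sP (n, u n) IH.
  split=> //=; [exact: cst_continuous|exact: cst_continuous|].
  by move=> x /eqP; rewrite oner_eq0.
have unext n : next n (u n) (u n.+1) by have [] := sP (n, u n) (uinv n).
have [|n x|n x|x|f [fu _ fc]] :=
    geometric_limit (u := fun n => (u n).1) (e := fun n => (u n).2).
- by move=> n x; have [] := uinv n.
- by have [] := unext n.
- by have [] := unext n.
- by rewrite /= lexx.
exists f; first by apply: fc => n; have [] := uinv n.
apply/seteqP; split=> x /=.
  (* On [F n] the tolerance of stage [n.+1] is 0, so the limit keeps the rational value of that
     stage. *)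
  rewrite AF => -[n _ Fx].
  have [_ _ _ /(_ x Fx) e0] := unext n.
  have := fu n.+1 x; rewrite e0 mulr0 normr_le0 subr_eq0 => /eqP ->.
  by have [_ _ _ /(_ x e0)[]] := uinv n.+1.
(* If the limit is [Q n], then [|u - Q n| <= 2 * e <= |u - Q n| / 2] at stage [n.+1]; so [e]
   vanishes there and [x] is frozen. *)
move=> /Qsurj[n fxQ]; have [_ _ /(_ x) eQ _] := unext n.
have := fu n.+1 x; rewrite distrC fxQ => fuQ.
have [_ _ /(_ x) e0 /(_ x) eA] := uinv n.+1.
suff /eA[] : (u n.+1).2 x = 0 by [].
by have := normr_ge0 ((u n.+1).1 x - Q n); lra.
Qed.

End DenseCase.

(** * Monotone functions collapsing the classes of an interpolative relation *)

Section Separation.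
Variables (R : realType) (prec : R -> R -> Prop).
Hypothesis prec_lt : forall x y, prec x y -> x < y.
Hypothesis prec_widen : forall x y x' y', x <= x' -> prec x' y' -> y' <= y -> prec x y.
Hypothesis prec_interp : forall x y, prec x y -> exists2 z, prec x z & prec z y.

Let prec_trans x y z : prec x y -> prec y z -> prec x z.
Proof. by move=> xy /prec_lt/ltW; exact: prec_widen xy. Qed.

(* Dyadically indexed points between [c] and [d], pairwise separated by [prec];
   [h x] is the supremum of the indices of the points below [x]. *)
Lemma prec_separation (c d : R) : prec c d -> exists h : R -> R,
  [/\ continuous h, {homo h : x y / x <= y}, forall x, 0 <= h x <= 1,
      forall x y, h x < h y -> prec x y & h c < h d].
Proof.
move=> cd.
have /choice[mid midP] : forall xy : R * R, exists z,
    prec xy.1 xy.2 -> prec xy.1 z /\ prec z xy.2.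
  move=> [x y]/=; have [/prec_interp[z xz zy]|nxy] := pselect (prec x y).
    by exists z.
  by exists x.
(* Level [n] has the points [z n 0], ..., [z n (2 ^ n)]: even indices repeat the previous level, odd
   ones interpolate between neighbours. *)
pose z := fix z n (k : nat) := if n is m.+1 then
    if odd k then mid (z m k./2, z m k./2.+1) else z m k./2
  else if k is 0 then c else d.
have zdouble n k : z n.+1 k.*2 = z n k by rewrite /= odd_double doubleK.
have zodd n k : z n.+1 k.*2.+1 = mid (z n k, z n k.+1).
  by rewrite /= odd_double uphalf_double.
have zprecS n k : (k < 2 ^ n)%N -> prec (z n k) (z n k.+1).
  elim: n k => [|n IH] k; first by case: k.
  rewrite -(odd_double_half k); move: (odd k) (k./2) => [] j;
    rewrite ?add1n ?add0n => kn;
    have jn : (j < 2 ^ n)%N by move: kn; rewrite expnS; lia.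
    by have [_] := midP (_, _) (IH j jn); rewrite -doubleS zdouble zodd.
  by have [+ _] := midP (_, _) (IH j jn); rewrite zdouble zodd.
have zprec n k l : (k < l <= 2 ^ n)%N -> prec (z n k) (z n l).
  elim: l => // l IH /andP[]; rewrite ltnS leq_eqVlt => /predU1P[->|kl] ln.
    exact: zprecS.
  by apply: (prec_trans (IH _) (zprecS _ _ ln)); rewrite kl ltnW.
have zshift n m k : z n k = z (n + m)%N (k * 2 ^ m)%N.
  elim: m => [|m IH]; first by rewrite addn0 expn0 muln1.
  by rewrite addnS expnS mulnCA mul2n zdouble.
have zmono n k m l : (k <= 2 ^ n)%N -> (l <= 2 ^ m)%N ->
    dyadic R n k < dyadic R m l -> prec (z n k) (z m l).
  move=> kn lm; rewrite (dyadic_shift _ n m) (dyadic_shift _ m n) (addnC m).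
  rewrite dyadic_lt -!natrX !natz -!PoszM ltz_nat => kl.
  rewrite (zshift n m) (zshift m n) (addnC m); apply: zprec; rewrite kl/=.
  by rewrite expnD mulnC leq_mul2l lm orbT.
pose D x := [set (0 : R)] `|`
  [set q | exists n (k : nat), [/\ (k <= 2 ^ n)%N, z n k <= x & q = dyadic R n k]].
have dyadic01 n k : (k <= 2 ^ n)%N -> 0 <= dyadic R n k <= 1.
  move=> kn; rewrite /dyadic exprVn divr_ge0 ?exprn_ge0//=.
  by rewrite ler_pdivrMr ?exprn_gt0// mul1r -natrX ler_nat.
have Db x : ubound (D x) 1.
  by move=> _ [->//|[n [k [/dyadic01/andP[_ +] _ ->]]]].
have Du x : has_ubound (D x) by exists 1.
have Dn x : D x !=set0 by exists 0; left.
pose h x := sup (D x).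
have hge n k x : (k <= 2 ^ n)%N -> z n k <= x -> dyadic R n k <= h x.
  by move=> kn zx; apply: ub_le_sup => //; right; exists n, k.
have hle n k x : (k <= 2 ^ n)%N -> x < z n k -> h x <= dyadic R n k.
  move=> kn xz; apply: ge_sup => // _ [->|[m [l [lm zx ->]]]].
    by have /andP[] := dyadic01 _ _ kn.
  rewrite leNgt; apply/negP => /(zmono _ _ _ _ kn lm)/prec_lt; lra.
have h01 x : 0 <= h x <= 1.
  by apply/andP; split; [apply: ub_le_sup => //; left|exact: ge_sup].
have hmono : {homo h : x y / x <= y}.
  move=> x y xy; apply: ge_sup => // _ [->|[n [k [kn zx ->]]]].
    by have /andP[] := h01 y.
  by apply: hge => //; exact: le_trans xy.
(* A second dyadic between the first and [h x] makes the inequality [z n k < x] strict. *)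
have below s x : 0 <= s -> s < h x -> exists n (k : nat),
    [/\ (k <= 2 ^ n)%N, s < dyadic R n k & z n k < x].
  move=> s0 sx; have /andP[hx0 hx1] := h01 x.
  have [n [k [kn /andP[sk kx]]]] := exists_dyadic_btw s0 sx hx1.
  have [m [l [lm /andP[kl lx]]]] := exists_dyadic_btw (le_trans s0 (ltW sk)) kx hx1.
  exists n, k; split=> //; have := prec_lt (zmono _ _ _ _ kn lm kl).
  by have [/(hle _ _ _ lm)|] := ltP x (z m l); lra.
have above t x : h x < t -> t <= 1 -> exists n (k : nat),
    [/\ (k <= 2 ^ n)%N, dyadic R n k < t & x < z n k].
  move=> xt t1; have /andP[hx0 hx1] := h01 x.
  have [n [k [kn /andP[xk kt]]]] := exists_dyadic_btw hx0 xt t1.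
  exists n, k; split=> //.
  by have [/(hge _ _ _ kn)|] := leP (z n k) x; lra.
exists h; split=> //.
- apply/continuous_epsP => x e e0.
  have [d1 d10 d1P] : exists2 d1, 0 < d1 & forall y, `|y - x| < d1 -> h x - e < h y.
    have [|s0] := ltP (h x - e) 0.
      by move=> s0; exists 1 => // y _; have /andP[] := h01 y; lra.
    have [|n [k [kn sk kx]]] := below _ x s0; first lra.
    exists (x - z n k) => [|y]; first by rewrite subr_gt0.
    by rewrite ltr_norml => yx; apply: (lt_le_trans sk); apply: hge => //; lra.
  have [d2 d20 d2P] : exists2 d2, 0 < d2 & forall y, `|y - x| < d2 -> h y < h x + e.
    have [|t1] := ltP 1 (h x + e).
      by move=> t1; exists 1 => // y _; have /andP[] := h01 y; lra.
    have [|n [k [kn kt xk]]] := above _ x _ t1; first lra.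
    exists (z n k - x) => [|y]; first by rewrite subr_gt0.
    by rewrite ltr_norml => yx; apply: le_lt_trans kt; apply: hle => //; lra.
  exists (Num.min d1 d2) => [|y]; first by rewrite lt_min d10.
  by rewrite lt_min => /andP[/d1P ? /d2P ?]; rewrite ltr_norml; apply/andP; split; lra.
- move=> x y xy; have /andP[hx0 hx1] := h01 x; have /andP[hy0 hy1] := h01 y.
  (* Grid points with indices on either side of the mean of [h x] and [h y] lie between [x] and [y]
     and are separated. *)
  have [n [k [kn kxy xk]]] := above ((h x + h y) / 2%:R) x ltac:(lra) ltac:(lra).
  have [m [l [lm lxy ly]]] := below ((h x + h y) / 2%:R) y ltac:(lra) ltac:(lra).
  by apply: prec_widen (ltW xk) (zmono _ _ _ _ kn lm _) (ltW ly); lra.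
(* The point [d] has index 1, while [c] lies below the point of index 1/2. *)
- have hd : 1 <= h d by have := @hge 0 1 d; rewrite /dyadic expr0 mulr1; apply.
  have : h c <= dyadic R 1 1.
    by apply: hle => //=; have [/prec_lt] := midP (c, d) cd.
  by rewrite /dyadic expr1 mul1r; lra.
Qed.

(* [phi] is the sum of [4^-i * h_i], where [h_i] separates the [i]-th pair of
   rationals. *)
Lemma prec_collapse : exists phi : R -> R,
  [/\ continuous phi, {homo phi : x y / x <= y} & forall x y, phi x < phi y <-> prec x y].
Proof.
have /choice[h hP] : forall i : nat, exists h : R -> R,
    [/\ continuous h, {homo h : x y / x <= y}, forall x, 0 <= h x <= 1,
        forall x y, h x < h y -> prec x y &
        forall c d : rat, unpickle i = Some (c, d) -> prec (ratr c) (ratr d) ->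
          h (ratr c) < h (ratr d)].
  move=> i; have h0 : exists h : R -> R, [/\ continuous h, {homo h : x y / x <= y},
      forall x, 0 <= h x <= 1 & forall x y, h x < h y -> prec x y].
    exists (cst 0); split=> [|//|x|x y]; first exact: cst_continuous.
      by rewrite lexx ler01.
    by rewrite ltxx.
  case: (unpickle i) => [[c d]|]; last by have [h [? ? ? ?]] := h0; exists h.
  have [cd|ncd] := pselect (prec (ratr c) (ratr d)).
    have [h [? ? ? ? hcd]] := prec_separation cd.
    by exists h; split=> // c' d' [<- <-].
  by have [h [? ? ? ?]] := h0; exists h; split=> // c' d' [<- <-].
pose u := fix u n : R -> R := if n is m.+1 then fun x => u m x + 4%:R^-1 ^+ m * h m x
  else fun=> 0.
have e0 n : 0 < 4%:R^-1 ^+ n :> R by rewrite exprn_gt0.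
have [n x|n x|n x|x|phi [phiu _ phic]] :=
    geometric_limit (u := u) (e := fun n _ => 4%:R^-1 ^+ n).
- exact: ltW.
- have [_ _ /(_ x)/andP[? ?] _ _] := hP n.
  rewrite [u _ _]/= addrAC subrr add0r ger0_norm ?mulr_ge0 ?(ltW (e0 n))//.
  by rewrite -[leRHS]mulr1 ler_pM2l.
- by rewrite exprSr lexx.
- by rewrite expr0 lexx.
have ulim N x y (r : R) : (forall n, (N <= n)%N -> u n x + r <= u n y) ->
    phi x + r <= phi y.
  move=> uxy; rewrite leNgt; apply/negP => yx.
  have [n nyx] : exists n, 4%:R^-1 ^+ n < (phi x + r - phi y) / 4%:R.
    by apply: exists_exprV_lt => //; lra.
  have : 4%:R^-1 ^+ (N + n) <= 4%:R^-1 ^+ n :> R.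
    rewrite exprD -[leRHS]mul1r ler_pM2r//.
    by apply: exprn_ile1; lra.
  have := uxy _ (leq_addr n N); have := phiu (N + n)%N x; have := phiu (N + n)%N y.
  by rewrite !ler_norml => /andP[? ?] /andP[? ?]; lra.
have uhomo x y : (forall i, h i x <= h i y) -> phi x <= phi y.
  move=> hxy; rewrite -[phi x]addr0; apply: (ulim 0%N) => n _; rewrite addr0.
  by elim: n => //= n IH; rewrite lerD// ler_pM2l.
exists phi; split.
- apply: phic; elim=> [|n IH]; first exact: cst_continuous.
  move=> x; apply: cvgD; first exact: IH.
  by apply: cvgM; [exact: cvg_cst|have [+ _ _ _ _] := hP n; apply].
- by move=> x y xy; apply: uhomo => i; have [_ + _ _ _] := hP i; apply.
move=> x y; split=> [|xy].
  apply: contraPP => nxy; apply/negP; rewrite -leNgt; apply: uhomo => i.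
  by rewrite leNgt; apply/negP => hxy; apply: nxy; have [_ _ _ + _] := hP i; apply.
(* Interpolating twice leaves room for rationals [c] in []x, z1[] and [d] in []z2, y[], which are
   separated because [z1] and [z2] are. *)
have [z1 xz1 z1y] := prec_interp xy; have [z2 z12 z2y] := prec_interp z1y.
have /rat_in_itvoo[c] := prec_lt xz1; rewrite in_itv/= => /andP[xc cz].
have /rat_in_itvoo[d] := prec_lt z2y; rewrite in_itv/= => /andP[zd dy].
have cd : prec (ratr c) (ratr d) by exact: prec_widen (ltW cz) z12 (ltW zd).
have [i iE] : exists i, unpickle i = Some (c, d) by exists (pickle (c, d)); exact: pickleK.
have hxy : h i x < h i y.
  have [_ hh _ _ /(_ c d iE cd)] := hP i.
  by have := hh _ _ (ltW xc); have := hh _ _ (ltW dy); lra.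
have r0 : 0 < 4%:R^-1 ^+ i * (h i y - h i x) by rewrite mulr_gt0 ?subr_gt0.
have hle j : h j x <= h j y by have [_ hh _ _ _] := hP j; apply/hh/ltW/prec_lt.
have ule n : u n x <= u n y by elim: n => //= n IH; rewrite lerD// ler_pM2l.
(* No term of the sum decreases from [x] to [y], and the [i]-th one contributes a fixed gap. *)
suff : phi x + 4%:R^-1 ^+ i * (h i y - h i x) <= phi y by lra.
apply: (ulim i.+1) => n; elim: n => // n IH.
rewrite ltnS leq_eqVlt => /predU1P[<-|/IH].
  by rewrite /= mulrBr; move: (ule i) (_ ^+ i : R) => ? ?; lra.
by have := hle n; rewrite -(ler_pM2l (e0 n)) /=; lra.
Qed.

End Separation.

(** * Condition (I) and reducibility to the rationals *)

Section Reducibility.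
Variable R : realType.
Implicit Types A K : set R.

(** If an end point [e] were mapped outside [K], [f] would take different values at [e] and at a
    point of the interval. By the intermediate value theorem it would take a value outside [K]
    strictly between them, at a point of the interval. *)
Lemma preimage_cond_I0 K (f : R -> R) : continuous f ->
  (forall x y, x < y -> exists2 p, ~ K p & x < p < y) -> cond_I0 (f @^-1` K).
Proof.
move=> fc Kd i [x [y [xi yi xy]]] iK e [b ie] /=.
apply: contrapT => nKe.
have [x0 [x0i x0e ei]] : exists x0, [/\ x0 \in i, x0 != e &
    forall c, Num.min e x0 <= c <= Num.max e x0 -> c != e -> c \in i].
  case: i xi yi ie {iK} => l r; rewrite !itv_boundlr => /andP[lx xr] /andP[ly yr] [/= lE|/= rE].
    have ey : e < y.
      by apply: le_lt_trans xy; move: lx; rewrite lE; case: (b); rewrite bnd_simp// => /ltW.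
    exists y; split; rewrite ?gt_eqF// ?itv_boundlr ?ly// => c.
    rewrite (min_idPl (ltW ey)) (max_idPr (ltW ey)) => /andP[ec cy] ce.
    have {ec ce} ec : e < c by rewrite lt_neqAle eq_sym ce.
    rewrite itv_boundlr lE; apply/andP; split.
      by case: (b); rewrite bnd_simp// ltW.
    by apply: le_trans yr; rewrite bnd_simp.
  have xe : x < e.
    by apply: (lt_le_trans xy); move: yr; rewrite rE; case: (b); rewrite bnd_simp// => /ltW.
  exists x; split; rewrite ?lt_eqF// ?itv_boundlr ?lx// => c.
  rewrite (min_idPr (ltW xe)) (max_idPl (ltW xe)) => /andP[xc ce] cne.
  have {ce cne} ce : c < e by rewrite lt_neqAle cne.
  rewrite itv_boundlr rE; apply/andP; split.
    by apply: (le_trans lx); rewrite bnd_simp.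
  by case: (b); rewrite bnd_simp// ltW.
have Kx0 : K (f x0) by exact: iK.
have fn : Num.min (f e) (f x0) < Num.max (f e) (f x0).
  have [fe|ef|fE] := ltgtP (f e) (f x0) => //.
  by case: nKe; rewrite /= fE.
have [v nKv /andP[v1 v2]] := Kd _ _ fn.
have [c ce fcv] : exists2 c, Num.min e x0 <= c <= Num.max e x0 & f c = v.
  have [ex|xe] := leP e x0.
    have [||c] := @IVT R f e x0 v ex.
    - exact: continuous_subspaceT.
    - by rewrite !ltW.
    by rewrite in_itv /=; exists c.
  have [||c] := @IVT R f x0 e v (ltW xe).
  - exact: continuous_subspaceT.
  - by rewrite minC maxC !ltW.
  by rewrite in_itv /=; exists c.
have cne : c != e.
  apply/eqP => cE; move: v1 v2; rewrite -fcv cE lt_max gt_min !ltxx/=.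
  by move=> h1 h2; have := lt_trans h1 h2; rewrite ltxx.
by apply: nKv; rewrite -fcv; apply: (iK c); exact: ei.
Qed.

Lemma cond_I0_itv K (x y : R) : cond_I0 K -> x < y ->
  (forall z, x < z < y -> K z) -> K x /\ K y.
Proof.
move=> KI xy Kxy.
have ne : nondegenerate_itv `]x, y[.
  exists (x + (y - x) / 3%:R), (x + (y - x) / 2%:R).
  by rewrite !in_itv/=; split; [apply/andP; split| apply/andP; split|]; lra.
have KP := KI _ ne (fun z => Kxy z).
(* The bounds of the open interval are [BSide false x] and [BSide true y]. *)
by split; apply: KP; [exists false; left|exists true; right].
Qed.

(** This is the order induced on equivalence classes: for [x < y] it says that [x] and [y] are
    inequivalent. *)
Definition cut (A : set R) (x y : R) :=
  x < y /\ (exists2 a, A a & x <= a <= y) /\ (exists2 b, ~ A b & x <= b <= y).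

Lemma cut_widen A x y x' y' : x <= x' -> cut A x' y' -> y' <= y -> cut A x y.
Proof.
move=> xx [xy' [[a Aa /andP[? ?]] [b nAb /andP[? ?]]]] yy; split; first lra.
by split; [exists a|exists b] => //; apply/andP; split; lra.
Qed.

(* If no point separates [x] from [y], let [s] be the supremum of the points not
   separated from [x]; by condition (I) both sides of [s] lie on the same side of [A]
   as [s]. *)
Lemma cut_interp A : cond_I A -> forall x y, cut A x y ->
  exists2 z, cut A x z & cut A z y.
Proof.
move=> [I0 I1] x y cxy; apply: contrapT => nz.
have {}nz z : ~ cut A x z \/ ~ cut A z y.
  by apply/not_andP => -[? ?]; apply: nz; exists z.
have [xy [[a Aa axy] [b nAb bxy]]] := cxy.
pose S := [set z | x <= z <= y /\ ~ cut A x z].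
have Sx : S x by split; [rewrite lexx ltW|move=> []; rewrite ltxx].
have Su : has_ubound S by exists y => z [/andP[]].
pose s := sup S.
have xs : x <= s by exact: ub_le_sup.
have sy : s <= y by apply: ge_sup; [exists x|move=> z [/andP[]]].
(* Some [t] in [S] exceeds both [u] and [v], and nothing separates [x] from [t]. *)
have left_s u v : x <= u < s -> x <= v < s -> A u -> A v.
  move=> /andP[xu us] /andP[xv vs] Au; apply: contrapT => nAv.
  have [||t [/andP[xt ty] nct]] := @sup_gt R S (Num.max u v); first by exists x.
    by rewrite gt_max us vs.
  rewrite gt_max => /andP[ut vt]; apply: nct; split; first lra.
  by split; [exists u|exists v] => //; apply/andP; split; lra.
(* A point beyond [s] is separated from [x], hence not from [y]. *)
have right_s u v : s < u <= y -> s < v <= y -> A u -> A v.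
  move=> /andP[su uy] /andP[sv vy] Au; apply: contrapT => nAv.
  have mu : Num.min u v <= u by rewrite ge_min lexx.
  have mv : Num.min u v <= v by rewrite ge_min lexx orbT.
  have sm : s < Num.min u v by rewrite lt_min su.
  have [ncx|ncy] := nz (Num.min u v).
    suff : Num.min u v <= s by lra.
    by apply: ub_le_sup => //; split=> //; apply/andP; split; lra.
  apply: ncy; split; last first.
    by split; [exists u|exists v] => //; apply/andP; split; lra.
  rewrite lt_neqAle; apply/andP; split; last lra.
  apply/eqP => mE; have uE : u = y by lra.
  by have vE : v = y by [lra]; apply: nAv; rewrite vE -uE.
have sideP z : x <= z <= y -> (A z -> A s) /\ (~ A z -> ~ A s).
  move=> /andP[xz zy]; have [zs|sz|->//] := ltgtP z s.
    have xs' : x < s by lra.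
    split=> Az.
      suff /(cond_I0_itv I0 xs')[] : forall w, x < w < s -> A w by [].
      move=> w /andP[? ?].
      by apply: (left_s z) => //; apply/andP; split; lra.
    suff /(cond_I0_itv I1 xs')[] : forall w, x < w < s -> ~ A w by [].
    move=> w /andP[? ?] Aw.
    by apply/Az/(left_s w) => //; apply/andP; split; lra.
  have sy' : s < y by lra.
  split=> Az.
    suff /(cond_I0_itv I0 sy')[] : forall w, s < w < y -> A w by [].
    move=> w /andP[? ?].
    by apply: (right_s z) => //; apply/andP; split; lra.
  suff /(cond_I0_itv I1 sy')[] : forall w, s < w < y -> ~ A w by [].
  move=> w /andP[? ?] Aw.
  by apply/Az/(right_s w) => //; apply/andP; split; lra.
by have [_ /(_ nAb)] := sideP b bxy; apply; have [+ _] := sideP a axy; apply.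
Qed.

Lemma cond_I_reducible A : Fsigma A -> cond_I A -> reducible A (@rational R).
Proof.
move=> [F Fc AF] AI.
have [phi [phic phih phiP]] :=
  prec_collapse (fun x y (c : cut A x y) => c.1) (@cut_widen A) (cut_interp AI).
have phiA x y : phi x = phi y -> A x -> A y.
  wlog xy : / x < y \/ y < x => [W E Ax|].
    by have [h|h|<-//] := ltgtP x y; apply: W => //; [left|right].
  move=> E Ax; apply: contrapT => nAy.
  have [{}xy|{}xy] := xy.
    suff /phiP : cut A x y by rewrite E ltxx.
    by split=> //; split; [exists x|exists y] => //; rewrite lexx ltW.
  suff /phiP : cut A y x by rewrite E ltxx.
  by split=> //; split; [exists x|exists y] => //; rewrite lexx ltW.
pose J := range phi.
(* Cutting [F m] down to compact pieces makes their images closed; the rationals outside [J] are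
   added one at a time. *)
pose G n : set R := if unpickle n is Some p then match p with
  | inl (m, k) => phi @` (F m `&` `[- k%:R, k%:R])
  | inr r => [set t | t = ratr r /\ ~ J t] end else set0.
pose B := \bigcup_n G n.
have unpickle_surj (p : nat * nat + rat) : exists n, unpickle n = Some p.
  by exists (pickle p); exact: pickleK.
have BJ t : B t <-> (phi @` A) t \/ (rational t /\ ~ J t).
  split=> [[n _]|].
    rewrite /G; case: (unpickle n) => [[[m k]|r]|//].
      by move=> [x [Fx _] <-]; left; exists x => //; rewrite AF; exists m.
    by move=> [-> nJ]; right; split=> //; exists r.
  move=> [[x Ax <-]|[[r _ <-] nJ]]; last first.
    by have [n nE] := unpickle_surj (inr r); exists n => //; rewrite /G nE.
  move: Ax; rewrite AF => -[m _ Fx].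
  have [n nE] := unpickle_surj (inl (m, Num.bound `|x|)).
  exists n => //; rewrite /G nE; exists x => //; split=> //=.
  rewrite in_itv/=; have := archi_boundP (normr_ge0 x).
  by rewrite ltr_norml => /andP[? ?]; apply/andP; split; lra.
have Jconv x y w : J x -> J y -> x <= w <= y -> J w.
  move=> [a _ <-] [b _ <-] w12; have [ab|ba] := leP a b.
    have [||c _ <-] := @IVT R phi a b w ab; [exact: continuous_subspaceT| |by exists c].
    by move/andP: w12 => [? ?]; rewrite ge_min le_max; apply/andP; split; apply/orP; [left|right].
  move/andP: w12 => [aw wb]; exists a => //; apply/eqP; rewrite eq_le aw.
  by rewrite (le_trans wb)// phih// ltW.
(* As [J] is convex, a point [p] outside it leaves one of its two sides free of [J]. *)
have Jsub s t : s < t -> exists s' t', [/\ s <= s', s' < t', t' <= t &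
    (forall w, s' < w < t' -> J w) \/ (forall w, s' < w < t' -> ~ J w)].
  move=> st; have [sub|] := pselect (forall w, s < w < t -> J w).
    by exists s, t; split=> //; left.
  move=> /existsNP[p /not_implyP[/andP[sp pt] nJ]].
  have [sub|] := pselect (forall w, s < w < p -> ~ J w).
    by exists s, p; split=> //; [exact: ltW|right].
  move=> /existsNP[w /not_implyP[/andP[sw wp] /contrapT Jw]].
  exists p, t; split=> //; first exact: ltW.
  right=> w' /andP[pw' _] Jw'; apply: nJ; apply: Jconv Jw Jw' _.
  by rewrite !ltW.
have Jdense s t : s < t -> (forall w, s < w < t -> J w) ->
    (exists2 p, B p & s < p < t) /\ (exists2 p, ~ B p & s < p < t).
  move=> st sub.
  have [x _ xE] : J (s + (t - s) / 3%:R) by apply: sub; apply/andP; split; lra.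
  have [y _ yE] : J (s + (t - s) / 2%:R) by apply: sub; apply/andP; split; lra.
  (* Interpolating twice puts a point of [A] and one of its complement in [[z1, z2]], whose image
     lies strictly between [phi x] and [phi y]. *)
  have /(cut_interp AI)[z1 xz1 /(cut_interp AI)[z2 [_ [[a Aa az] [b nAb bz]]] zy]] :
    cut A x y by apply/phiP; rewrite xE yE; lra.
  have btw w : z1 <= w <= z2 -> s < phi w < t.
    move=> /andP[/phih h1 /phih h2].
    by move/phiP: xz1; move/phiP: zy => ? ?; apply/andP; split; lra.
  split; [exists (phi a)|exists (phi b)]; [|exact: btw| |exact: btw].
    by apply/BJ; left; exists a.
  move=> /BJ[[a' Aa' /phiA/(_ Aa')//]|[_]]; apply.
  by exists b.
have [|//|s t|s t|f fc BE] := @dense_codense_reducible R B G.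
- move=> n; rewrite /G; case: (unpickle n) => [[[m k]|r]|]; last exact: closed0.
    apply: compact_closed; first exact: Rhausdorff.
    apply: continuous_compact; first exact: continuous_subspaceT.
    by rewrite setIC; apply: compact_closedI => //; exact: segment_compact.
  have [Jr|nJr] := pselect (J (ratr r)).
    suff -> : [set t | t = ratr r /\ ~ J t] = set0 by exact: closed0.
    by rewrite -subset0 => t [->].
  suff -> : [set t | t = ratr r /\ ~ J t] = [set ratr r].
    by apply: compact_closed; [exact: Rhausdorff|exact: compact_set1].
  by apply/seteqP; split=> t; [move=> []|move=> ->].
- move=> /Jsub[s' [t' [ss st tt [sub|sub]]]].
    have [[p Bp /andP[? ?]] _] := Jdense _ _ st sub.
    by exists p => //; apply/andP; split; lra.
  have [p pQ pst] := exists_rational_btw st.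
  exists p; first by apply/BJ; right; split=> //; exact: sub.
  by move/andP: pst => [? ?]; apply/andP; split; lra.
- move=> /Jsub[s' [t' [ss st tt [sub|sub]]]].
    have [_ [p nBp /andP[? ?]]] := Jdense _ _ st sub.
    by exists p => //; apply/andP; split; lra.
  have [p pQ pst] := exists_irrational_btw st.
  exists p; last by move/andP: pst => [? ?]; apply/andP; split; lra.
  move=> /BJ[[x _ xp]|[]//]; apply: (sub p) => //.
  by exists x.
exists (f \o phi).
  by move=> x; apply: continuous_comp; [exact: phic|exact: fc].
apply/seteqP; split=> x; rewrite [X in _ -> X]/= [X in X -> _]/= => H.
  suff : B (phi x) by rewrite BE.
  by apply/BJ; left; exists x.
have /BJ[[y Ay yx]|[_ []]] : B (phi x) by rewrite BE.
  exact: phiA yx Ay.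
by exists x.
Qed.

End Reducibility.

Theorem theorem1p5 (R : realType) (A : set R) (A_nontrivial : nontrivial_set A)
    (A_Fsigma : Fsigma A) :
  cond_I A <-> reducible A (@rational R).
Proof.
split=> [|[f fc ->]]; first exact: cond_I_reducible.
split.
  by apply: preimage_cond_I0 => // x y; exact: exists_irrational_btw.
(* The complement of the preimage is the preimage of the irrationals, and the rationals are
   dense. *)
apply: (@preimage_cond_I0 R (~` rational)) => // x y.
by move=> /exists_rational_btw[q qQ xqy]; exists q => // /(_ qQ).
Qed.
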